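(* Suppose the agents start from a collision-free configuration, i.e. $x_i(1)\neq x_j(1)$ for all $i\neq j$, and that every agent $i=1,\dots,N$ runs the projection algorithm described in the context. Then the algorithm is collision free: for every $t=1,\dots,T$ and all $i\ne j$, $\|x_i(t)-x_j(t)\|_2>0$.
   Context: There are $N$ agents; $x_i(t)\in\mathbb{R}^n$ is the position of agent $i$ at discrete time $t$. Dynamics are single-integrator: $x_i(t+1)=x_i(t)+u_i(t)$ with $\|u_i(t)\|_2\le u^{\max}$, with the same $u^{\max}>0$ for all agents. At each time $t=1,\dots,T$, each agent $i$ knows its own position exactly and, for every $j\ne i$, maintains an uncertainty ellipsoid $\mathcal{E}_i^j(t)\subset\mathbb{R}^n$ (a closed solid ellipsoid of nonzero volume) such that the true position $x_j(t)$ lies in the interior of $\mathcal{E}_i^j(t)$. Different agents' ellipsoids need not be consistent with each other, and their sizes are not restricted. For a point $z$ and a set $\mathcal{E}$, $\|z-\mathcal{E}\|_2=\inf_{y\in\mathcal{E}}\|z-y\|_2$. The generalized Voronoi cell (safe-reachable set) of agent $i$ at time $t$ is $$S_i(t)=\{z\in\mathbb{R}^n : \|z-x_i(t)\|_2\le \|z-\mathcal{E}_i^j(t)\|_2 \text{ for all } j=1,\dots,N,\ j\ne i\}.$$ The reachable set $R_i(t)$ of agent $i$ is expressed relative to its current position: $x_i(t)+R_i(t)=S_i(t)\cap\{z:\|z-x_i(t)\|_2\le u^{\max}\}$, where $v+M=\{v+w: w\in M\}$. Each agent $i$ has an (arbitrary) goal point in $\mathbb{R}^n$. The projection function $P_i(x_i,\mathcal{E}_i,t)$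 returns either the Euclidean projection of agent $i$'s goal onto $x_i(t)+R_i(t)$, or the symbol $\neg$, indicating that the projection failed (for instance when agent $i$'s uncertainty about agent $j$ is so large that $\mathcal{E}_i^j(t)$ contains $x_i(t)$). Projection algorithm (run simultaneously by all agents): for $t=1,\dots,T$, compute $q=P_i(x_i,\mathcal{E}_i,t)$; if $q=\neg$ set $x_i(t+1)=x_i(t)$; otherwise set $x_i(t+1)=q$. *)

(* Defs.v *)
From HB Require Import structures.
From mathcomp Require Import all_boot all_order all_algebra.
From mathcomp Require Import all_classical all_reals all_analysis.

Set Implicit Arguments.
Unset Strict Implicit.
Unset Printing Implicit Defensive.

Import Order.TTheory GRing.Theory Num.Theory.
Import numFieldTopology.Exports numFieldNormedType.Exports.

Local Open Scope classical_set_scope.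
Local Open Scope ring_scope.

(* Points of R^n are row vectors.  The library norm on
   'rV[R]_n is the sup norm, so the Euclidean norm is introduced here; the
   library topology on 'rV[R]_n (hence `interior`) is the usual one of R^n. *)
Definition norm2 (R : realType) (n : nat) (v : 'rV[R]_n) : R :=
  Num.sqrt (\sum_(k < n) v 0 k ^+ 2).

(* The library `inf` of a set of reals is 0 on the empty set; here E is always an
   ellipsoid, hence nonempty. *)
Definition dist2 (R : realType) (n : nat) (z : 'rV[R]_n) (E : set 'rV[R]_n) : R :=
  inf [set norm2 (z - y) | y in E].

(* Affine image of the closed unit ball; invertibility of A is what makes the
   volume nonzero. *)
Definition is_ellipsoid (R : realType) (n : nat) (E : set 'rV[R]_n) : Prop :=
  exists (c : 'rV[R]_n) (A : 'M[R]_n), A \in unitmx /\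
    E = [set c + v *m A | v in [set v : 'rV[R]_n | norm2 v <= 1]].

Definition translate (R : realType) (n : nat) (v : 'rV[R]_n)
    (M : set 'rV[R]_n) : set 'rV[R]_n :=
  [set v + w | w in M].

Definition is_euclidean_projection (R : realType) (n : nat)
    (K : set 'rV[R]_n) (g q : 'rV[R]_n) : Prop :=
  K q /\ forall w, K w -> norm2 (g - q) <= norm2 (g - w).

Section Agents.
Variables (R : realType) (n N : nat).

Definition trajectory := nat -> 'rV[R]_n.

(* For Ei of this type belonging to agent i, Ei j t is the uncertainty
   ellipsoid of agent i about agent j at time t; Ei i t carries no meaning. *)
Definition uncertainty := 'I_N -> nat -> set 'rV[R]_n.

Definition safe_cell (i : 'I_N) (xi : trajectory) (Ei : uncertainty) (t : nat) :
    set 'rV[R]_n :=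
  [set z | forall j : 'I_N, j != i -> norm2 (z - xi t) <= dist2 z (Ei j t)].

(* Relative to the current position, so that x_i(t) + R_i(t) is the
   intersection of S_i(t) with the ball of radius umax around x_i(t). *)
Definition reachable_set (umax : R) (i : 'I_N) (xi : trajectory)
    (Ei : uncertainty) (t : nat) : set 'rV[R]_n :=
  [set w | safe_cell i xi Ei t (xi t + w) /\ norm2 (xi t + w - xi t) <= umax].

(* None is the failure symbol.  A projection function may fail on any input;
   it is only constrained on inputs that are ellipsoids. *)
Definition is_projection_function (T : nat) (umax : R) (i : 'I_N)
    (goal : 'rV[R]_n)
    (Pi : trajectory -> uncertainty -> nat -> option 'rV[R]_n) : Prop :=
  forall (xi : trajectory) (Ei : uncertainty) (t : nat),
    (1 <= t <= T)%N ->
    (forall j : 'I_N, j != i -> is_ellipsoid (Ei j t)) ->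
    if Pi xi Ei t is Some q then
      is_euclidean_projection
        (translate (xi t) (reachable_set umax i xi Ei t)) goal q
    else True.

Definition single_integrator (T : nat) (umax : R) (xi ui : trajectory) : Prop :=
  forall t : nat, (1 <= t <= T)%N ->
    xi t.+1 = xi t + ui t /\ norm2 (ui t) <= umax.

Definition runs_projection_algorithm (T : nat)
    (Pi : trajectory -> uncertainty -> nat -> option 'rV[R]_n)
    (xi : trajectory) (Ei : uncertainty) : Prop :=
  forall t : nat, (1 <= t <= T)%N ->
    xi t.+1 = if Pi xi Ei t is Some q then q else xi t.

End Agents.

(* Main.v *)
Require Import Defs.
From mathcomp Require Import all_boot all_order all_algebra.
From mathcomp Require Import all_classical all_reals all_analysis.
Import Order.TTheory GRing.Theory Num.Theory.
Import numFieldTopology.Exports numFieldNormedType.Exports.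
Local Open Scope classical_set_scope.
Local Open Scope ring_scope.

(** Two agents never meet because they stay on opposite open sides of the
    perpendicular bisector between their current positions.  Suppose that x_i(t)
    and x_j(t) differ.  Then agent i always moves to a point strictly closer to
    x_i(t) than to x_j(t): if its projection fails it stays
    at x_i(t), and otherwise it moves into its generalized Voronoi cell, all of
    whose points have this property ([safe_cell_closer]).  Agent j symmetrically
    moves to a point strictly closer to x_j(t) than to x_i(t), so the two new
    positions differ, and collision freedom propagates by induction on time.

    Strictness in the cell is where x_j(t) being interior to the ellipsoid is
    used: a point z other than x_j(t) is strictly closer to the ellipsoid than
    to x_j(t), since one can walk from x_j(t) a little towards z without leaving
    the ellipsoid ([dist2_interior_lt]).  The point z = x_j(t) itself is not in
    the cell, because it is at distance 0 from the ellipsoid but at positive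
    distance from x_i(t). *)

Section EuclideanNorm.
Context {R : realType} {n : nat}.
Implicit Types (v z : 'rV[R]_n) (E : set 'rV[R]_n).

Lemma norm2_ge0 v : 0 <= norm2 v.
Proof. exact: sqrtr_ge0. Qed.

Lemma norm2_0 : norm2 (0 : 'rV[R]_n) = 0.
Proof.
rewrite /norm2 big1 ?sqrtr0// => k _.
by rewrite mxE expr0n.
Qed.

Lemma norm2_eq0 v : (norm2 v == 0) = (v == 0).
Proof.
apply/idP/eqP => [|->]; last by rewrite norm2_0.
have sq_ge0 (k : 'I_n) : true -> 0 <= v 0 k ^+ 2 by rewrite sqr_ge0.
rewrite /norm2 sqrtr_eq0 => sum_le0; apply/rowP => k; rewrite mxE.
have /eqP/psumr_eq0P/(_ k isT) : \sum_(k < n) v 0 k ^+ 2 == 0.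
  by rewrite eq_le sum_le0 sumr_ge0.
by move=> /(_ sq_ge0)/eqP; rewrite sqrf_eq0 => /eqP.
Qed.

Lemma norm2_gt0 v : (0 < norm2 v) = (v != 0).
Proof. by rewrite lt_def norm2_ge0 norm2_eq0 andbT. Qed.

Lemma norm2Z (a : R) v : norm2 (a *: v) = `|a| * norm2 v.
Proof.
rewrite /norm2 -sqrtr_sqr -sqrtrM ?sqr_ge0//; congr Num.sqrt.
by rewrite mulr_sumr; apply: eq_bigr => k _; rewrite mxE exprMn.
Qed.

Lemma dist2_le {z E y} : E y -> dist2 z E <= norm2 (z - y).
Proof.
move=> Ey; apply: ge_inf; last by exists y.
by exists 0 => _ [w _ <-]; exact: norm2_ge0.
Qed.

(** Openness allows a step of relative length [e] from [y] towards [z] that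
    stays in [E]; it shortens the distance to [z] by the factor [1 - e]. *)
Lemma dist2_interior_lt {z E y} :
  (interior E) y -> z != y -> dist2 z E < norm2 (z - y).
Proof.
move=> Ey zy.
pose step (e : R) : 'rV[R]_n := y + e *: (z - y).
have step_cvg : step e @[e --> (0 : R)] --> y.
  have step0 : step 0 = y by rewrite /step scale0r addr0.
  by rewrite -step0; apply: cvgD; [exact: cvg_cst|apply: cvgZr_tmp; exact: cvg_id].
have /nbhs_ballP[r /= r0 rE] := step_cvg _ Ey.
(* Below r, to stay in E, and below 1, so that 1 - e is the shortening factor. *)
pose e : R := Num.min (r / 2) (1 / 2).
have e0 : 0 < e by rewrite lt_min !divr_gt0.
have er : e < r by rewrite gt_min ltr_pdivrMr// ltr_pMr// ltr1n.
have e1 : e < 1 by rewrite gt_min [1 / 2 < 1]ltr_pdivrMr// mul1r ltr1n orbT.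
have Estep : E (step e).
  by apply: rE; rewrite /ball /= sub0r normrN gtr0_norm.
apply: le_lt_trans (dist2_le Estep) _.
have -> : z - step e = (1 - e) *: (z - y).
  by rewrite scalerBl scale1r /step opprD addrA.
rewrite norm2Z gtr0_norm ?subr_gt0// gtr_pMl ?norm2_gt0 ?subr_eq0//.
by rewrite gtrBl.
Qed.

End EuclideanNorm.

(** The cell is defined by a non-strict inequality with the ellipsoid, so the
    gain has to come from [y] being interior to it. *)
Lemma safe_cell_closer {R : realType} {n N : nat} {i j : 'I_N}
    {xi : trajectory R n} {Ei : uncertainty R n N} {t : nat} {y z : 'rV[R]_n} :
  j != i -> (interior (Ei j t)) y -> xi t != y ->
  safe_cell i xi Ei t z -> norm2 (z - xi t) < norm2 (z - y).
Proof.
move=> ji Ey xiy /(_ j ji) z_safe.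
have [zy|zy] := eqVneq z y; last first.
  exact: le_lt_trans z_safe (dist2_interior_lt Ey zy).
(* The point y is at distance 0 from the ellipsoid, hence not in the cell. *)
move: z_safe; rewrite zy => /le_trans/(_ (dist2_le (interior_subset Ey))).
rewrite subrr norm2_0 => y_le0; exfalso.
suff : 0 < norm2 (y - xi t) by rewrite ltNge y_le0.
by rewrite norm2_gt0 subr_eq0 eq_sym.
Qed.

(** Failure and success of the projection are treated alike here: in both cases
    the agent stays on its own side of the bisector with [y]. *)
Lemma projection_step_closer {R : realType} {n N T : nat} {umax : R}
    {i j : 'I_N} {goal : 'rV[R]_n}
    {Pi : trajectory R n -> uncertainty R n N -> nat -> option 'rV[R]_n}
    {xi : trajectory R n} {Ei : uncertainty R n N} {t : nat} {y : 'rV[R]_n} :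
  is_projection_function T umax i goal Pi ->
  runs_projection_algorithm T Pi xi Ei ->
  (1 <= t <= T)%N -> (forall k, k != i -> is_ellipsoid (Ei k t)) ->
  j != i -> (interior (Ei j t)) y -> xi t != y ->
  norm2 (xi t.+1 - xi t) < norm2 (xi t.+1 - y).
Proof.
move=> projPi runPi tT ellEi ji Ey xiy; rewrite (runPi t tT).
have := projPi xi Ei t tT ellEi; case: (Pi xi Ei t) => [q|_].
  by move=> [[w [w_safe _] <-] _]; exact: safe_cell_closer ji Ey xiy w_safe.
by rewrite subrr norm2_0 norm2_gt0 subr_eq0.
Qed.

Theorem theorem1 (R : realType) (n N T : nat) (umax : R)
  (goal : 'I_N -> 'rV[R]_n)
  (P : 'I_N -> trajectory R n -> uncertainty R n N -> nat -> option 'rV[R]_n)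
  (x u : 'I_N -> trajectory R n)
  (E : 'I_N -> uncertainty R n N)
  (umax_gt0 : 0 < umax)
  (dynamics : forall i : 'I_N, single_integrator T umax (x i) (u i))
  (ellipsoids : forall (i j : 'I_N) (t : nat), (1 <= t <= T)%N -> j != i ->
     is_ellipsoid (E i j t))
  (true_position : forall (i j : 'I_N) (t : nat), (1 <= t <= T)%N -> j != i ->
     (interior (E i j t)) (x j t))
  (projections : forall i : 'I_N,
     is_projection_function T umax i (goal i) (P i))
  (algorithm : forall i : 'I_N,
     runs_projection_algorithm T (P i) (x i) (E i))
  (start : forall i j : 'I_N, i != j -> x i 1%N <> x j 1%N) :
  forall (t : nat) (i j : 'I_N), (1 <= t <= T)%N -> i != j ->
    0 < norm2 (x i t - x j t).
Proof.
move=> t i j tT ij; rewrite norm2_gt0 subr_eq0.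
elim: t tT => [//|t IH] tT.
have [t0|t_gt0] := posnP t; first by rewrite t0; apply/eqP; exact: start.
have {}tT : (1 <= t <= T)%N by rewrite t_gt0 ltnW.
have xij := IH tT.
have ji : j != i by rewrite eq_sym.
have i_closer := projection_step_closer
  (projections i) (algorithm i) tT (fun k => ellipsoids i k t tT) ji
  (true_position i j t tT ji) xij.
have xji : x j t != x i t by rewrite eq_sym.
have j_closer := projection_step_closer
  (projections j) (algorithm j) tT (fun k => ellipsoids j k t tT) ij
  (true_position j i t tT ij) xji.
apply/eqP => meet; move: i_closer; rewrite meet => /lt_trans/(_ j_closer).
by rewrite ltxx.
Qed.
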